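(* Let $S=(A,H,V,C)$ be a double signature. The translation $t$ from 2-cell expressions over $S$ to 2-morphisms of the free 2-category $S_2$ respects the axioms of double categories: if two 2-cell expressions $\phi,\psi$ represent the same 2-cell of the free double category $S_d$, then $t(\phi)=t(\psi)$ in $S_2$. Hence $t$ extends to a map from 2-cells in $S_d$ to 2-cells in $S_2$.
   Context: A double signature $S=(A,H,V,C)$ consists of a set $A$ of objects, a set $H$ of generating horizontal morphisms, a set $V$ of generating vertical morphisms, and a set $C$ of generating 2-cells. Each $h\in H$ and each $v\in V$ has a domain and codomain in $A$; $H^*$ and $V^*$ denote the free categories so generated. Each $\alpha\in C$ has a horizontal domain (top) $\mathrm{domh}\,\alpha$ and codomain (bottom) $\mathrm{codh}\,\alpha$ in $H^*$, and a vertical domain (left) $\mathrm{domv}\,\alpha$ and codomain (right) $\mathrm{codv}\,\alpha$ in $V^*$, bounding a square: $\mathrm{dom}\,\mathrm{domh}\,\alpha=\mathrm{dom}\,\mathrm{domv}\,\alpha$, $\mathrm{cod}\,\mathrm{domh}\,\alpha=\mathrm{dom}\,\mathrm{codv}\,\alpha$, $\mathrm{cod}\,\mathrm{domv}\,\alpha=\mathrm{dom}\,\mathrm{codh}\,\alpha$, $\mathrm{cod}\,\mathrm{codh}\,\alpha=\mathrm{cod}\,\mathrm{codv}\,\alpha$. 2-cell expressions are generated inductively from $C$ and the identity cells on morphisms of $H^*$ and of $V^*$, by horizontal composition (of cells sharing a vertical boundary) and vertical composition (of cells sharing a horizontal boundary). The 2-cells of the free double category $S_d$ are expressions modulo the congruence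 generated by the laws of double categories: unitality and associativity of both compositions, exchange, compatibility of identity cells with composition of boundary morphisms, and equality of the two identity cells on each identity morphism. Write $f;g$ for ''first $f$, then $g$''. $S_2$ is the free 2-category generated by the objects $a\in A$; the 1-morphisms $h:\mathrm{dom}\,h\to\mathrm{cod}\,h$ for $h\in H$ and $v^{\mathrm{op}}:\mathrm{cod}\,v\to\mathrm{dom}\,v$ for $v\in V$ (with $(v_1;v_2)^{\mathrm{op}}=v_2^{\mathrm{op}};v_1^{\mathrm{op}}$); and, for $\alpha\in C$, a 2-morphism $\alpha:(\mathrm{domv}\,\alpha)^{\mathrm{op}};\mathrm{domh}\,\alpha\to\mathrm{codh}\,\alpha;(\mathrm{codv}\,\alpha)^{\mathrm{op}}$. For an expression $\phi$, the 2-morphism $t(\phi):(\mathrm{domv}\,\phi)^{\mathrm{op}};\mathrm{domh}\,\phi\to\mathrm{codh}\,\phi;(\mathrm{codv}\,\phi)^{\mathrm{op}}$ is defined inductively: a generator $\alpha$ goes to the generator $\alpha$; the identity cell on $h\in H^*$ goes to the identity 2-morphism on $h$; the identity cell on $v\in V^*$ goes to the identity 2-morphism on $v^{\mathrm{op}}$; the horizontal composite of $\mu$ (left) and $\nu$ (right) goes to $t(\mu)$ whiskered by $\mathrm{domh}\,\nu$ on the right, followed by $t(\nu)$ whiskered by $\mathrm{codh}\,\mu$ on the left; the vertical composite of $\mu$ (top) and $\nu$ (bottom) goes to $t(\mu)$ whiskered by $(\mathrm{domv}\,\nu)^{\mathrm{op}}$ on the left, followed by $t(\nu)$ whiskered by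 $(\mathrm{codv}\,\mu)^{\mathrm{op}}$ on the right. *)

(* Defs.v *)
From HB Require Import structures.
From mathcomp Require Import all_boot.
From mathcomp Require Import boolp.

Set Implicit Arguments.
Unset Strict Implicit.
Unset Printing Implicit Defensive.

Local Open Scope quotient_scope.

Record graph (A : Type) : Type := Graph {
  edge :> Type;
  dom : edge -> A;
  cod : edge -> A
}.

Inductive free (A : Type) (G : graph A) : A -> A -> Type :=
| fid a : free G a a
| fcons (e : G) b : free G (cod e) b -> free G (dom e) b.

Arguments fid {A G} a.

Fixpoint fcomp (A : Type) (G : graph A) (a b c : A) (p : free G a b) :
    free G b c -> free G a c :=
  match p in free _ a b return free G b c -> free G a c with
  | fid _ => fun q => q
  | fcons e _ p' => fun q => fcons (fcomp p' q)
  end.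

(** Composition in diagrammatic order: first [p], then [q]. *)
Notation "p ;; q" := (fcomp p q) (at level 41, right associativity).

Definition fgen (A : Type) (G : graph A) (e : G) : free G (dom e) (cod e) :=
  fcons (fid (cod e)).

Section FreeCategoryLaws.
Variables (A : Type) (G : graph A).

Lemma fcompA (a b c d : A) (p : free G a b) (q : free G b c) (r : free G c d) :
  (p ;; q) ;; r = p ;; (q ;; r).
Proof. by elim: p q => [//|e x p IH] q /=; rewrite IH. Qed.

Lemma fcomp1 (a b : A) (p : free G a b) : p ;; fid b = p.
Proof. by elim: p => [//|e x p IH] /=; rewrite IH. Qed.

End FreeCategoryLaws.

(** The four equations making the boundary of a generating 2-cell a square are
    built into the types, the corners [tl], [tr], [bl], [br] being the common
    endpoints. *)
Record double_signature : Type := DoubleSignature {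
  obj : Type;
  hor : graph obj;
  ver : graph obj;
  gcell : Type;
  tl : gcell -> obj;
  tr : gcell -> obj;
  bl : gcell -> obj;
  br : gcell -> obj;
  domh : forall al : gcell, free hor (tl al) (tr al);
  codh : forall al : gcell, free hor (bl al) (br al);
  domv : forall al : gcell, free ver (tl al) (bl al);
  codv : forall al : gcell, free ver (tr al) (br al)
}.

(** [expr h k v w] is the type of 2-cell expressions with top [h], bottom [k],
    left [v] and right [w]. *)
Inductive expr (S : double_signature) : forall a b c d : obj S,
    free (hor S) a b -> free (hor S) c d ->
    free (ver S) a c -> free (ver S) b d -> Type :=
| egen (al : gcell S) : expr (domh al) (codh al) (domv al) (codv al)
| eidh a b (h : free (hor S) a b) : expr h h (fid a) (fid b)
| eidv a c (v : free (ver S) a c) : expr (fid a) (fid c) v v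
| ehcomp a b b' c d d'
    (h : free (hor S) a b) (h' : free (hor S) b b')
    (k : free (hor S) c d) (k' : free (hor S) d d')
    (u : free (ver S) a c) (v : free (ver S) b d) (w : free (ver S) b' d') :
    expr h k u v -> expr h' k' v w -> expr (h ;; h') (k ;; k') u w
| evcomp a b c d c' d'
    (h : free (hor S) a b) (k : free (hor S) c d) (l : free (hor S) c' d')
    (v : free (ver S) a c) (v' : free (ver S) c c')
    (w : free (ver S) b d) (w' : free (ver S) d d') :
    expr h k v w -> expr k l v' w' -> expr h l (v ;; v') (w ;; w').

(** The congruence generated by the laws of double categories. Boundaries such
    as [(h ;; h') ;; h''] and [h ;; (h' ;; h'')] are equal but not convertible,
    so the two sides may have syntactically different boundaries, which are
    nevertheless equal by [cell_eq_boundary] below. *)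
Inductive cell_eq (S : double_signature) : forall (a b c d : obj S)
    (h : free (hor S) a b) (k : free (hor S) c d)
    (v : free (ver S) a c) (w : free (ver S) b d)
    (h' : free (hor S) a b) (k' : free (hor S) c d)
    (v' : free (ver S) a c) (w' : free (ver S) b d),
    expr h k v w -> expr h' k' v' w' -> Prop :=
| ce_refl a b c d (h : free (hor S) a b) (k : free (hor S) c d)
    (v : free (ver S) a c) (w : free (ver S) b d) (f : expr h k v w) :
    cell_eq f f
| ce_sym a b c d (h h' : free (hor S) a b) (k k' : free (hor S) c d)
    (v v' : free (ver S) a c) (w w' : free (ver S) b d)
    (f : expr h k v w) (f' : expr h' k' v' w') :
    cell_eq f f' -> cell_eq f' f
| ce_trans a b c d (h h' h'' : free (hor S) a b) (k k' k'' : free (hor S) c d)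
    (v v' v'' : free (ver S) a c) (w w' w'' : free (ver S) b d)
    (f : expr h k v w) (f' : expr h' k' v' w') (f'' : expr h'' k'' v'' w'') :
    cell_eq f f' -> cell_eq f' f'' -> cell_eq f f''
| ce_hcomp a b b' c d d'
    (h1 h2 : free (hor S) a b) (h1' h2' : free (hor S) b b')
    (k1 k2 : free (hor S) c d) (k1' k2' : free (hor S) d d')
    (u1 u2 : free (ver S) a c) (v1 v2 : free (ver S) b d)
    (w1 w2 : free (ver S) b' d')
    (f1 : expr h1 k1 u1 v1) (g1 : expr h1' k1' v1 w1)
    (f2 : expr h2 k2 u2 v2) (g2 : expr h2' k2' v2 w2) :
    cell_eq f1 f2 -> cell_eq g1 g2 -> cell_eq (ehcomp f1 g1) (ehcomp f2 g2)
| ce_vcomp a b c d c' d'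
    (h1 h2 : free (hor S) a b) (k1 k2 : free (hor S) c d)
    (l1 l2 : free (hor S) c' d')
    (v1 v2 : free (ver S) a c) (v1' v2' : free (ver S) c c')
    (w1 w2 : free (ver S) b d) (w1' w2' : free (ver S) d d')
    (f1 : expr h1 k1 v1 w1) (g1 : expr k1 l1 v1' w1')
    (f2 : expr h2 k2 v2 w2) (g2 : expr k2 l2 v2' w2') :
    cell_eq f1 f2 -> cell_eq g1 g2 -> cell_eq (evcomp f1 g1) (evcomp f2 g2)
| ce_hunitl a b c d (h : free (hor S) a b) (k : free (hor S) c d)
    (v : free (ver S) a c) (w : free (ver S) b d) (f : expr h k v w) :
    cell_eq (ehcomp (eidv v) f) f
| ce_hunitr a b c d (h : free (hor S) a b) (k : free (hor S) c d)
    (v : free (ver S) a c) (w : free (ver S) b d) (f : expr h k v w) :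
    cell_eq (ehcomp f (eidv w)) f
| ce_vunitl a b c d (h : free (hor S) a b) (k : free (hor S) c d)
    (v : free (ver S) a c) (w : free (ver S) b d) (f : expr h k v w) :
    cell_eq (evcomp (eidh h) f) f
| ce_vunitr a b c d (h : free (hor S) a b) (k : free (hor S) c d)
    (v : free (ver S) a c) (w : free (ver S) b d) (f : expr h k v w) :
    cell_eq (evcomp f (eidh k)) f
| ce_hassoc a0 a1 a2 a3 b0 b1 b2 b3
    (h1 : free (hor S) a0 a1) (h2 : free (hor S) a1 a2)
    (h3 : free (hor S) a2 a3)
    (k1 : free (hor S) b0 b1) (k2 : free (hor S) b1 b2)
    (k3 : free (hor S) b2 b3)
    (v0 : free (ver S) a0 b0) (v1 : free (ver S) a1 b1)
    (v2 : free (ver S) a2 b2) (v3 : free (ver S) a3 b3)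
    (f : expr h1 k1 v0 v1) (g : expr h2 k2 v1 v2) (i : expr h3 k3 v2 v3) :
    cell_eq (ehcomp (ehcomp f g) i) (ehcomp f (ehcomp g i))
| ce_vassoc a0 a1 a2 a3 b0 b1 b2 b3
    (v1 : free (ver S) a0 a1) (v2 : free (ver S) a1 a2)
    (v3 : free (ver S) a2 a3)
    (w1 : free (ver S) b0 b1) (w2 : free (ver S) b1 b2)
    (w3 : free (ver S) b2 b3)
    (h0 : free (hor S) a0 b0) (h1 : free (hor S) a1 b1)
    (h2 : free (hor S) a2 b2) (h3 : free (hor S) a3 b3)
    (f : expr h0 h1 v1 w1) (g : expr h1 h2 v2 w2) (i : expr h2 h3 v3 w3) :
    cell_eq (evcomp (evcomp f g) i) (evcomp f (evcomp g i))
| ce_exchange a0 a1 a2 b0 b1 b2 c0 c1 c2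
    (h1 : free (hor S) a0 a1) (h2 : free (hor S) a1 a2)
    (k1 : free (hor S) b0 b1) (k2 : free (hor S) b1 b2)
    (l1 : free (hor S) c0 c1) (l2 : free (hor S) c1 c2)
    (u1 : free (ver S) a0 b0) (u2 : free (ver S) b0 c0)
    (v1 : free (ver S) a1 b1) (v2 : free (ver S) b1 c1)
    (w1 : free (ver S) a2 b2) (w2 : free (ver S) b2 c2)
    (f1 : expr h1 k1 u1 v1) (f2 : expr h2 k2 v1 w1)
    (g1 : expr k1 l1 u2 v2) (g2 : expr k2 l2 v2 w2) :
    cell_eq (evcomp (ehcomp f1 f2) (ehcomp g1 g2))
            (ehcomp (evcomp f1 g1) (evcomp f2 g2))
| ce_idh_comp a b c (h : free (hor S) a b) (h' : free (hor S) b c) :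
    cell_eq (ehcomp (eidh h) (eidh h')) (eidh (h ;; h'))
| ce_idv_comp a b c (v : free (ver S) a b) (v' : free (ver S) b c) :
    cell_eq (evcomp (eidv v) (eidv v')) (eidv (v ;; v'))
| ce_idid (a : obj S) : cell_eq (eidh (fid a)) (eidv (fid a)).

Lemma cell_eq_boundary (S : double_signature) (a b c d : obj S)
    (h h' : free (hor S) a b) (k k' : free (hor S) c d)
    (v v' : free (ver S) a c) (w w' : free (ver S) b d)
    (f : expr h k v w) (f' : expr h' k' v' w') :
  cell_eq f f' -> [/\ h = h', k = k', v = v' & w = w'].
Proof.
elim=> {a b c d h h' k k' v v' w w' f f'} *;
  repeat match goal with H : and4 _ _ _ _ |- _ => destruct H end;
  split; rewrite ?fcompA ?fcomp1 //=; congruence.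
Qed.

Section Cells.
Variables (S : double_signature) (a b c d : obj S).
Variables (h : free (hor S) a b) (k : free (hor S) c d).
Variables (v : free (ver S) a c) (w : free (ver S) b d).

HB.instance Definition _ := gen_eqMixin (expr h k v w).
HB.instance Definition _ := gen_choiceMixin (expr h k v w).

Definition cell_eqb : rel (expr h k v w) := fun f f' => `[< cell_eq f f' >].

Fact cell_eqb_refl : reflexive cell_eqb.
Proof. by move=> f; apply/asboolP; constructor. Qed.

Fact cell_eqb_sym : symmetric cell_eqb.
Proof. by move=> f g; apply/asboolP/asboolP; apply: ce_sym. Qed.

Fact cell_eqb_trans : transitive cell_eqb.
Proof.
by move=> g f i /asboolP fg /asboolP gi; apply/asboolP; apply: ce_trans fg gi.
Qed.

Canonical cell_equiv :=
  EquivRel cell_eqb cell_eqb_refl cell_eqb_sym cell_eqb_trans.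

(** The 2-cells of the free double category with the given boundary. *)
Definition Sd_cell := {eq_quot cell_equiv}.
HB.instance Definition _ := EqQuotient.on Sd_cell.
HB.instance Definition _ := Choice.on Sd_cell.

End Cells.

(** [inr v] is the formal 1-morphism "v^op". *)
Definition graph2 (S : double_signature) : graph (obj S) :=
  @Graph (obj S) (hor S + ver S)%type
    (fun e => match e with inl h => dom h | inr v => cod v end)
    (fun e => match e with inl h => cod h | inr v => dom v end).

Fixpoint hmor (S : double_signature) (a b : obj S) (p : free (hor S) a b) :
    free (graph2 S) a b :=
  match p in free _ a b return free (graph2 S) a b with
  | fid a => fid a
  | fcons h _ p' => fgen (inl h : graph2 S) ;; hmor p'
  end.

Fixpoint vop (S : double_signature) (a b : obj S) (p : free (ver S) a b) :
    free (graph2 S) b a :=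
  match p in free _ a b return free (graph2 S) b a with
  | fid a => fid a
  | fcons v _ p' => vop p' ;; fgen (inr v : graph2 S)
  end.

Section BoundaryLaws.
Variable S : double_signature.

Lemma hmor_comp (a b c : obj S) (p : free (hor S) a b) (q : free (hor S) b c) :
  hmor (p ;; q) = hmor p ;; hmor q.
Proof. by elim: p q => [//|e x p IH] q /=; rewrite IH. Qed.

Lemma vop_comp (a b c : obj S) (p : free (ver S) a b) (q : free (ver S) b c) :
  vop (p ;; q) = vop q ;; vop p.
Proof.
by elim: p q => [x|e x p IH] q /=; rewrite ?fcomp1 // IH fcompA.
Qed.

End BoundaryLaws.

Inductive expr2 (S : double_signature) : forall a b : obj S,
    free (graph2 S) a b -> free (graph2 S) a b -> Type :=
| gen2 (al : gcell S) :
    expr2 (vop (domv al) ;; hmor (domh al)) (hmor (codh al) ;; vop (codv al))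
| id2 a b (p : free (graph2 S) a b) : expr2 p p
| vcomp2 a b (p q r : free (graph2 S) a b) :
    expr2 p q -> expr2 q r -> expr2 p r
| hcomp2 a b c (p q : free (graph2 S) a b) (p' q' : free (graph2 S) b c) :
    expr2 p q -> expr2 p' q' -> expr2 (p ;; p') (q ;; q').

(** The congruence generated by the laws of (strict) 2-categories; as for
    [cell_eq], the two sides may have boundaries that are equal but not
    convertible. *)
Inductive mor2_eq (S : double_signature) : forall (a b : obj S)
    (p q p' q' : free (graph2 S) a b), expr2 p q -> expr2 p' q' -> Prop :=
| me_refl a b (p q : free (graph2 S) a b) (x : expr2 p q) : mor2_eq x x
| me_sym a b (p q p' q' : free (graph2 S) a b)
    (x : expr2 p q) (x' : expr2 p' q') :
    mor2_eq x x' -> mor2_eq x' x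
| me_trans a b (p q p' q' p'' q'' : free (graph2 S) a b)
    (x : expr2 p q) (x' : expr2 p' q') (x'' : expr2 p'' q'') :
    mor2_eq x x' -> mor2_eq x' x'' -> mor2_eq x x''
| me_vcomp a b (p1 q1 r1 p2 q2 r2 : free (graph2 S) a b)
    (x1 : expr2 p1 q1) (y1 : expr2 q1 r1)
    (x2 : expr2 p2 q2) (y2 : expr2 q2 r2) :
    mor2_eq x1 x2 -> mor2_eq y1 y2 -> mor2_eq (vcomp2 x1 y1) (vcomp2 x2 y2)
| me_hcomp a b c (p1 q1 p2 q2 : free (graph2 S) a b)
    (p1' q1' p2' q2' : free (graph2 S) b c)
    (x1 : expr2 p1 q1) (y1 : expr2 p1' q1')
    (x2 : expr2 p2 q2) (y2 : expr2 p2' q2') :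
    mor2_eq x1 x2 -> mor2_eq y1 y2 -> mor2_eq (hcomp2 x1 y1) (hcomp2 x2 y2)
| me_vunitl a b (p q : free (graph2 S) a b) (x : expr2 p q) :
    mor2_eq (vcomp2 (id2 p) x) x
| me_vunitr a b (p q : free (graph2 S) a b) (x : expr2 p q) :
    mor2_eq (vcomp2 x (id2 q)) x
| me_vassoc a b (p q r s : free (graph2 S) a b)
    (x : expr2 p q) (y : expr2 q r) (z : expr2 r s) :
    mor2_eq (vcomp2 (vcomp2 x y) z) (vcomp2 x (vcomp2 y z))
| me_hunitl a b (p q : free (graph2 S) a b) (x : expr2 p q) :
    mor2_eq (hcomp2 (id2 (fid a)) x) x
| me_hunitr a b (p q : free (graph2 S) a b) (x : expr2 p q) :
    mor2_eq (hcomp2 x (id2 (fid b))) x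
| me_hassoc a b c d (p q : free (graph2 S) a b) (p' q' : free (graph2 S) b c)
    (p'' q'' : free (graph2 S) c d)
    (x : expr2 p q) (y : expr2 p' q') (z : expr2 p'' q'') :
    mor2_eq (hcomp2 (hcomp2 x y) z) (hcomp2 x (hcomp2 y z))
| me_hid a b c (p : free (graph2 S) a b) (q : free (graph2 S) b c) :
    mor2_eq (hcomp2 (id2 p) (id2 q)) (id2 (p ;; q))
| me_exchange a b c (p q r : free (graph2 S) a b)
    (p' q' r' : free (graph2 S) b c)
    (x : expr2 p q) (y : expr2 q r) (x' : expr2 p' q') (y' : expr2 q' r') :
    mor2_eq (hcomp2 (vcomp2 x y) (vcomp2 x' y'))
            (vcomp2 (hcomp2 x x') (hcomp2 y y')).

Lemma mor2_eq_boundary (S : double_signature) (a b : obj S)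
    (p q p' q' : free (graph2 S) a b) (x : expr2 p q) (x' : expr2 p' q') :
  mor2_eq x x' -> p = p' /\ q = q'.
Proof.
elim=> {a b p q p' q' x x'} *;
  repeat match goal with H : _ /\ _ |- _ => destruct H end;
  split; rewrite ?fcompA ?fcomp1 //=; congruence.
Qed.

Section Morphisms2.
Variables (S : double_signature) (a b : obj S) (p q : free (graph2 S) a b).

HB.instance Definition _ := gen_eqMixin (expr2 p q).
HB.instance Definition _ := gen_choiceMixin (expr2 p q).

Definition mor2_eqb : rel (expr2 p q) := fun x x' => `[< mor2_eq x x' >].

Fact mor2_eqb_refl : reflexive mor2_eqb.
Proof. by move=> x; apply/asboolP; constructor. Qed.

Fact mor2_eqb_sym : symmetric mor2_eqb.
Proof. by move=> x y; apply/asboolP/asboolP; apply: me_sym. Qed.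

Fact mor2_eqb_trans : transitive mor2_eqb.
Proof.
by move=> y x z /asboolP xy /asboolP yz; apply/asboolP; apply: me_trans xy yz.
Qed.

Canonical mor2_equiv :=
  EquivRel mor2_eqb mor2_eqb_refl mor2_eqb_sym mor2_eqb_trans.

(** The 2-morphisms [p -> q] of the free 2-category. *)
Definition S2_mor := {eq_quot mor2_equiv}.
HB.instance Definition _ := EqQuotient.on S2_mor.
HB.instance Definition _ := Choice.on S2_mor.

End Morphisms2.

Definition cast2 (S : double_signature) (a b : obj S)
    (p q p' q' : free (graph2 S) a b) (ep : p = p') (eq' : q = q')
    (x : expr2 p q) : expr2 p' q' :=
  match ep in _ = p1, eq' in _ = q1 return expr2 p1 q1 with
  | erefl, erefl => x
  end.

Definition whiskerl (S : double_signature) (a b c : obj S)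
    (r : free (graph2 S) a b) (p q : free (graph2 S) b c) (x : expr2 p q) :
    expr2 (r ;; p) (r ;; q) :=
  hcomp2 (id2 r) x.

Definition whiskerr (S : double_signature) (a b c : obj S)
    (p q : free (graph2 S) a b) (x : expr2 p q) (r : free (graph2 S) b c) :
    expr2 (p ;; r) (q ;; r) :=
  hcomp2 x (id2 r).

Section TranslationBoundaries.
Variable S : double_signature.

Lemma t_idh_cod (a b : obj S) (h : free (hor S) a b) :
  hmor h = hmor h ;; vop (fid b).
Proof. by rewrite fcomp1. Qed.

Lemma t_idv_dom (a c : obj S) (v : free (ver S) a c) :
  vop v = vop v ;; hmor (fid a).
Proof. by rewrite fcomp1. Qed.

Lemma t_hcomp_dom (a b b' c : obj S) (h : free (hor S) a b)
    (h' : free (hor S) b b') (u : free (ver S) a c) :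
  (vop u ;; hmor h) ;; hmor h' = vop u ;; hmor (h ;; h').
Proof. by rewrite hmor_comp fcompA. Qed.

Lemma t_hcomp_cod (b' c d d' : obj S) (k : free (hor S) c d)
    (k' : free (hor S) d d') (w : free (ver S) b' d') :
  hmor k ;; (hmor k' ;; vop w) = hmor (k ;; k') ;; vop w.
Proof. by rewrite hmor_comp fcompA. Qed.

Lemma t_vcomp_dom (a b c c' : obj S) (h : free (hor S) a b)
    (v : free (ver S) a c) (v' : free (ver S) c c') :
  vop v' ;; (vop v ;; hmor h) = vop (v ;; v') ;; hmor h.
Proof. by rewrite vop_comp fcompA. Qed.

Lemma t_vcomp_cod (b d c' d' : obj S) (l : free (hor S) c' d')
    (w : free (ver S) b d) (w' : free (ver S) d d') :
  (hmor l ;; vop w') ;; vop w = hmor l ;; vop (w ;; w').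
Proof. by rewrite vop_comp fcompA. Qed.

End TranslationBoundaries.

(** The casts only identify equal composites of 1-morphisms; "followed by" is
    the vertical composition [vcomp2]. *)
Fixpoint t (S : double_signature) (a b c d : obj S)
    (h : free (hor S) a b) (k : free (hor S) c d)
    (v : free (ver S) a c) (w : free (ver S) b d) (f : expr h k v w) :
    expr2 (vop v ;; hmor h) (hmor k ;; vop w) :=
  match f in @expr _ a b c d h k v w
    return expr2 (vop v ;; hmor h) (hmor k ;; vop w) with
  | egen al => gen2 al
  | eidh _ _ h => cast2 erefl (t_idh_cod h) (id2 (hmor h))
  | eidv _ _ v => cast2 (t_idv_dom v) erefl (id2 (vop v))
  | ehcomp _ _ _ _ _ _ h h' k k' u v w m n =>
      cast2 (t_hcomp_dom h h' u) (t_hcomp_cod k k' w)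
        (vcomp2
           (whiskerr (t m) (hmor h'))
           (cast2 (esym (fcompA (hmor k) (vop v) (hmor h'))) erefl
              (whiskerl (hmor k) (t n))))
  | evcomp _ _ _ _ _ _ h k l v v' w w' m n =>
      cast2 (t_vcomp_dom h v v') (t_vcomp_cod l w w')
        (vcomp2
           (whiskerl (vop v') (t m))
           (cast2 (fcompA (vop v') (hmor k) (vop w)) erefl
              (whiskerr (t n) (vop w))))
  end.

(* Main.v *)
(** Up to [mor2_eq] every cast disappears, so each law of double categories
    becomes an identity between composites of whiskered 2-morphisms in [S2].
    Associativity of the two compositions is functoriality of whiskering; the
    exchange law is the interchange law of [S2] applied to the top right cell
    [f2] and the bottom left cell [g1], which act on disjoint parts of the
    1-morphism. *)

Require Import Defs.
From mathcomp Require Import all_boot.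
From mathcomp Require Import boolp.
Local Open Scope quotient_scope.

Set Implicit Arguments.
Unset Strict Implicit.
Unset Printing Implicit Defensive.

(** * Vertical composition in the free 2-category across boundary casts *)

Section TwoCategory.
Variable S : double_signature.
Implicit Types a b c d : obj S.

(** Composition along a propositional equality of 1-morphisms; the second
    factors of [t] on composites are literally of this shape. *)
Definition vcomp_cast a b (p q q' r : free (graph2 S) a b) (e : q' = q)
    (x : expr2 p q) (y : expr2 q' r) : expr2 p r :=
  vcomp2 x (cast2 e erefl y).

Lemma mor2_eq_cast a b (p q p' q' : free (graph2 S) a b) (ep : p = p')
    (eq' : q = q') (x : expr2 p q) : mor2_eq (cast2 ep eq' x) x.
Proof. by case: _ / ep; case: _ / eq'; apply: me_refl. Qed.

Lemma mor2_eq_id a b (p q : free (graph2 S) a b) :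
  p = q -> mor2_eq (id2 p) (id2 q).
Proof. by move=> ->; apply: me_refl. Qed.

Lemma vcomp_cast_eq a b (p q q' r p1 q1 q1' r1 : free (graph2 S) a b)
    (e : q' = q) (e1 : q1' = q1) (x : expr2 p q) (y : expr2 q' r)
    (x1 : expr2 p1 q1) (y1 : expr2 q1' r1) :
  mor2_eq x x1 -> mor2_eq y y1 ->
  mor2_eq (vcomp_cast e x y) (vcomp_cast e1 x1 y1).
Proof.
move=> xx1 yy1; apply: me_vcomp xx1 _.
apply: me_trans (mor2_eq_cast _ _ _) _.
by apply: me_trans yy1 _; apply: me_sym (mor2_eq_cast _ _ _).
Qed.

(** Serves the unit laws and the laws for composites of identity cells: there one factor of [t] is a
    whiskered identity, congruent to [id2 s] for an [s] that need not be convertible to its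
    boundary. *)
Lemma vcomp_cast_idl a b (p p' q q' r r' s : free (graph2 S) a b)
    (e : q' = q) (x : expr2 p q) (y : expr2 q' r) (z : expr2 p' r') :
  mor2_eq x (id2 s) -> mor2_eq y z -> mor2_eq (vcomp_cast e x y) z.
Proof.
move=> xs yz; have [_ qs] := mor2_eq_boundary xs; subst q' s.
apply: me_trans (me_vcomp xs (me_refl _)) _.
exact: me_trans (me_vunitl _) yz.
Qed.

Lemma vcomp_cast_idr a b (p p' q q' r r' s : free (graph2 S) a b)
    (e : q' = q) (x : expr2 p q) (y : expr2 q' r) (z : expr2 p' r') :
  mor2_eq y (id2 s) -> mor2_eq x z -> mor2_eq (vcomp_cast e x y) z.
Proof.
move=> ys xz; have [qs _] := mor2_eq_boundary ys; subst q q'.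
apply: me_trans (me_vcomp (me_refl _) ys) _.
exact: me_trans (me_vunitr _) xz.
Qed.

Lemma vcomp_castA a b (p q q' r r' s : free (graph2 S) a b) (e : q' = q)
    (e' : r' = r) (x : expr2 p q) (y : expr2 q' r) (z : expr2 r' s) :
  mor2_eq (vcomp_cast e' (vcomp_cast e x y) z)
          (vcomp_cast e x (vcomp_cast e' y z)).
Proof. by subst q r; apply: me_vassoc. Qed.

(** The inner composites [xy] and [yz'] are given only up to [mor2_eq], so that whiskered
    translations of composite cells can be plugged in directly; associativity then reduces to
    comparing three factors one by one. *)
Lemma vcomp_cast_assoc a b
    (p q q1 r r1 r2 s p0 : free (graph2 S) a b)
    (p' q' q1' q2' r' r1' s' s0' : free (graph2 S) a b)
    (e1 : q1 = q) (e2 : r2 = r1) (e1' : r1' = r') (e2' : q2' = q')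
    (x : expr2 p q) (y : expr2 q1 r) (z : expr2 r2 s) (xy : expr2 p0 r1)
    (x' : expr2 p' q') (y' : expr2 q1' r') (z' : expr2 r1' s')
    (yz' : expr2 q2' s0') :
  mor2_eq xy (vcomp_cast e1 x y) -> mor2_eq yz' (vcomp_cast e1' y' z') ->
  mor2_eq x x' -> mor2_eq y y' -> mor2_eq z z' ->
  mor2_eq (vcomp_cast e2 xy z) (vcomp_cast e2' x' yz').
Proof.
move=> xyE yzE xx' yy' zz'.
have [ep er] := mor2_eq_boundary xyE; have [eq' es] := mor2_eq_boundary yzE.
subst p0 q1 r1 r2 q2' r1' q' s0'.
apply: me_trans (vcomp_cast_eq erefl erefl xyE (me_refl z)) _.
apply: me_trans (vcomp_castA _ _ _ _ _) _.
apply: vcomp_cast_eq xx' (me_trans _ (me_sym yzE)).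
exact: vcomp_cast_eq yy' zz'.
Qed.

(** Prepares the exchange law: of the four factors, the two inner ones are brought together so that
    they can be interchanged. *)
Lemma vcomp_cast_middle a b
    (p0 p1 p1' p2 p2' p3 p3' p4 q q0 q4 q' : free (graph2 S) a b)
    (e1 : p1' = p1) (e2 : p2' = p2) (e3 : p3' = p3) (e : q4 = q0)
    (x0 : expr2 p0 p1) (x1 : expr2 p1' p2) (x2 : expr2 p2' p3)
    (x3 : expr2 p3' p4) (y : expr2 q q0) (z : expr2 q4 q') :
  mor2_eq y (vcomp_cast e1 x0 x1) -> mor2_eq z (vcomp_cast e3 x2 x3) ->
  mor2_eq (vcomp_cast e y z)
          (vcomp_cast e1 x0 (vcomp_cast e3 (vcomp_cast e2 x1 x2) x3)).
Proof.
move=> yE zE; apply: vcomp_cast_assoc yE _ (me_refl _) (me_refl _) zE.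
exact: vcomp_castA.
Qed.

(** * Functoriality and interchange of whiskering *)

Lemma whiskerl_eq a b c (r r' : free (graph2 S) a b)
    (p q p' q' : free (graph2 S) b c) (x : expr2 p q) (x' : expr2 p' q') :
  r = r' -> mor2_eq x x' -> mor2_eq (whiskerl r x) (whiskerl r' x').
Proof. by move=> rr'; apply: me_hcomp (mor2_eq_id rr'). Qed.

Lemma whiskerr_eq a b c (r r' : free (graph2 S) b c)
    (p q p' q' : free (graph2 S) a b) (x : expr2 p q) (x' : expr2 p' q') :
  r = r' -> mor2_eq x x' -> mor2_eq (whiskerr x r) (whiskerr x' r').
Proof. by move=> rr' xx'; apply: me_hcomp xx' (mor2_eq_id rr'). Qed.

Lemma whiskerl_vcomp a b c (r : free (graph2 S) a b)
    (p q q' s p' s' : free (graph2 S) b c) (e : q' = q)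
    (x : expr2 p q) (y : expr2 q' s) (z : expr2 p' s') :
  mor2_eq z (vcomp_cast e x y) ->
  mor2_eq (whiskerl r z)
          (vcomp_cast (f_equal (fcomp r) e) (whiskerl r x) (whiskerl r y)).
Proof.
subst q => zxy; apply: me_trans (whiskerl_eq erefl zxy) _.
apply: me_trans (me_exchange _ _ _ _).
(* The whiskering identity is split as [id2 r] followed by [id2 r], the form that exchange
   requires. *)
exact: me_hcomp (me_sym (me_vunitl _)) (me_refl _).
Qed.

Lemma whiskerr_vcomp a b c (r : free (graph2 S) b c)
    (p q q' s p' s' : free (graph2 S) a b) (e : q' = q)
    (x : expr2 p q) (y : expr2 q' s) (z : expr2 p' s') :
  mor2_eq z (vcomp_cast e x y) ->
  mor2_eq (whiskerr z r)
          (vcomp_cast (f_equal (fun p => p ;; r) e)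
             (whiskerr x r) (whiskerr y r)).
Proof.
subst q => zxy; apply: me_trans (whiskerr_eq erefl zxy) _.
apply: me_trans (me_exchange _ _ _ _).
exact: me_hcomp (me_refl _) (me_sym (me_vunitl _)).
Qed.

Lemma whiskerl_comp a b c d (r : free (graph2 S) a b) (s : free (graph2 S) b c)
    (p q : free (graph2 S) c d) (x : expr2 p q) :
  mor2_eq (whiskerl r (whiskerl s x)) (whiskerl (r ;; s) x).
Proof.
apply: me_trans (me_sym (me_hassoc _ _ _)) _.
exact: me_hcomp (me_hid _ _) (me_refl _).
Qed.

Lemma whiskerr_comp a b c d (r : free (graph2 S) b c) (s : free (graph2 S) c d)
    (p q : free (graph2 S) a b) (x : expr2 p q) :
  mor2_eq (whiskerr (whiskerr x r) s) (whiskerr x (r ;; s)).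
Proof.
apply: me_trans (me_hassoc _ _ _) _.
exact: me_hcomp (me_refl _) (me_hid _ _).
Qed.

(** By exchange and the unit laws, both orders equal the horizontal composite [hcomp2 x y]. *)
Lemma whisker_interchange a b c (p q : free (graph2 S) a b)
    (p' q' : free (graph2 S) b c) (x : expr2 p q) (y : expr2 p' q') :
  mor2_eq (vcomp_cast erefl (whiskerl p y) (whiskerr x q'))
          (vcomp_cast erefl (whiskerr x p') (whiskerl q y)).
Proof.
apply: me_trans (me_sym (me_exchange _ _ _ _)) _.
apply: me_trans (me_exchange _ _ _ _).
apply: me_hcomp.
  exact: me_trans (me_vunitl _) (me_sym (me_vunitr _)).
exact: me_trans (me_vunitr _) (me_sym (me_vunitl _)).
Qed.

End TwoCategory.

(** * The translation of each law of double categories *)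

Section Translation.
Variable S : double_signature.

Lemma t_eidh (a b : obj S) (h : free (hor S) a b) :
  mor2_eq (t (eidh h)) (id2 (hmor h)).
Proof. exact: mor2_eq_cast. Qed.

Lemma t_eidv (a b : obj S) (v : free (ver S) a b) :
  mor2_eq (t (eidv v)) (id2 (vop v)).
Proof. exact: mor2_eq_cast. Qed.

Lemma t_ehcomp (a b b' c d d' : obj S)
    (h : free (hor S) a b) (h' : free (hor S) b b')
    (k : free (hor S) c d) (k' : free (hor S) d d')
    (u : free (ver S) a c) (v : free (ver S) b d) (w : free (ver S) b' d')
    (f : expr h k u v) (g : expr h' k' v w) :
  mor2_eq (t (ehcomp f g))
    (vcomp_cast (esym (fcompA (hmor k) (vop v) (hmor h')))
       (whiskerr (t f) (hmor h')) (whiskerl (hmor k) (t g))).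
Proof. exact: mor2_eq_cast. Qed.

Lemma t_evcomp (a b c d c' d' : obj S)
    (h : free (hor S) a b) (k : free (hor S) c d) (l : free (hor S) c' d')
    (v : free (ver S) a c) (v' : free (ver S) c c')
    (w : free (ver S) b d) (w' : free (ver S) d d')
    (f : expr h k v w) (g : expr k l v' w') :
  mor2_eq (t (evcomp f g))
    (vcomp_cast (fcompA (vop v') (hmor k) (vop w))
       (whiskerl (vop v') (t f)) (whiskerr (t g) (vop w))).
Proof. exact: mor2_eq_cast. Qed.

Lemma t_hassoc (a0 a1 a2 a3 b0 b1 b2 b3 : obj S)
    (h1 : free (hor S) a0 a1) (h2 : free (hor S) a1 a2)
    (h3 : free (hor S) a2 a3)
    (k1 : free (hor S) b0 b1) (k2 : free (hor S) b1 b2)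
    (k3 : free (hor S) b2 b3)
    (v0 : free (ver S) a0 b0) (v1 : free (ver S) a1 b1)
    (v2 : free (ver S) a2 b2) (v3 : free (ver S) a3 b3)
    (f : expr h1 k1 v0 v1) (g : expr h2 k2 v1 v2) (i : expr h3 k3 v2 v3) :
  mor2_eq (t (ehcomp (ehcomp f g) i)) (t (ehcomp f (ehcomp g i))).
Proof.
apply: me_trans (t_ehcomp _ _) _; apply: me_trans _ (me_sym (t_ehcomp _ _)).
apply: vcomp_cast_assoc (whiskerr_vcomp _ (t_ehcomp f g))
  (whiskerl_vcomp _ (t_ehcomp g i)) _ _ _.
- apply: me_trans (whiskerr_comp _ _ _) _.
  exact: whiskerr_eq (esym (hmor_comp _ _)) (me_refl _).
(* The middle cell [g] is whiskered by [k1] on the left and [h3] on the right; the two sides differ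
   only in the order of these whiskerings. *)
- exact: me_hassoc.
- apply: me_trans _ (me_sym (whiskerl_comp _ _ _)).
  exact: whiskerl_eq (hmor_comp _ _) (me_refl _).
Qed.

Lemma t_vassoc (a0 a1 a2 a3 b0 b1 b2 b3 : obj S)
    (v1 : free (ver S) a0 a1) (v2 : free (ver S) a1 a2)
    (v3 : free (ver S) a2 a3)
    (w1 : free (ver S) b0 b1) (w2 : free (ver S) b1 b2)
    (w3 : free (ver S) b2 b3)
    (h0 : free (hor S) a0 b0) (h1 : free (hor S) a1 b1)
    (h2 : free (hor S) a2 b2) (h3 : free (hor S) a3 b3)
    (f : expr h0 h1 v1 w1) (g : expr h1 h2 v2 w2) (i : expr h2 h3 v3 w3) :
  mor2_eq (t (evcomp (evcomp f g) i)) (t (evcomp f (evcomp g i))).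
Proof.
apply: me_trans (t_evcomp _ _) _; apply: me_trans _ (me_sym (t_evcomp _ _)).
apply: vcomp_cast_assoc (whiskerl_vcomp _ (t_evcomp f g))
  (whiskerr_vcomp _ (t_evcomp g i)) _ _ _.
- apply: me_trans (whiskerl_comp _ _ _) _.
  exact: whiskerl_eq (esym (vop_comp _ _)) (me_refl _).
- exact: me_sym (me_hassoc _ _ _).
- apply: me_trans _ (me_sym (whiskerr_comp _ _ _)).
  exact: whiskerr_eq (vop_comp _ _) (me_refl _).
Qed.

Lemma t_exchange (a0 a1 a2 b0 b1 b2 c0 c1 c2 : obj S)
    (h1 : free (hor S) a0 a1) (h2 : free (hor S) a1 a2)
    (k1 : free (hor S) b0 b1) (k2 : free (hor S) b1 b2)
    (l1 : free (hor S) c0 c1) (l2 : free (hor S) c1 c2)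
    (u1 : free (ver S) a0 b0) (u2 : free (ver S) b0 c0)
    (v1 : free (ver S) a1 b1) (v2 : free (ver S) b1 c1)
    (w1 : free (ver S) a2 b2) (w2 : free (ver S) b2 c2)
    (f1 : expr h1 k1 u1 v1) (f2 : expr h2 k2 v1 w1)
    (g1 : expr k1 l1 u2 v2) (g2 : expr k2 l2 v2 w2) :
  mor2_eq (t (evcomp (ehcomp f1 f2) (ehcomp g1 g2)))
          (t (ehcomp (evcomp f1 g1) (evcomp f2 g2))).
Proof.
apply: me_trans (t_evcomp _ _) _; apply: me_trans _ (me_sym (t_ehcomp _ _)).
(* Both sides unfold to four factors, in the order [f1], [f2], [g1], [g2] here and [f1], [g1], [f2],
   [g2] on the other side. The side condition left each time says that the two middle factors meet
   up to bracketing. *)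
apply: me_trans (vcomp_cast_middle _ _
  (whiskerl_vcomp (vop u2) (t_ehcomp f1 f2))
  (whiskerr_vcomp (vop w1) (t_ehcomp g1 g2))) _.
  by rewrite !fcompA.
move=> e.
apply: me_trans _ (me_sym (vcomp_cast_middle _ _
  (whiskerr_vcomp (hmor h2) (t_evcomp f1 g1))
  (whiskerl_vcomp (hmor l1) (t_evcomp f2 g2)))).
  by rewrite !fcompA.
move=> e'.
apply: vcomp_cast_eq (me_sym (me_hassoc _ _ _)) _.
apply: vcomp_cast_eq _ (me_hassoc _ _ _).
(* Merging nested whiskerings exhibits the middle pair as [t f2] whiskered by the domain of [t g1],
   then [t g1] whiskered by the codomain of [t f2]. *)
apply: me_trans (vcomp_cast_eq _ erefl (whiskerl_comp _ _ _)
  (whiskerr_comp _ _ _)) _.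
apply: me_trans (whisker_interchange _ _) _.
apply: me_sym; apply: vcomp_cast_eq (whiskerr_comp _ _ _) _.
exact: whiskerl_comp.
Qed.

Lemma t_eq (a b c d : obj S) (h h' : free (hor S) a b)
    (k k' : free (hor S) c d) (v v' : free (ver S) a c)
    (w w' : free (ver S) b d) (f : expr h k v w) (f' : expr h' k' v' w') :
  cell_eq f f' -> mor2_eq (t f) (t f').
Proof.
elim=> {a b c d h h' k k' v v' w w' f f'}.
- by move=> *; apply: me_refl.
- by move=> *; apply: me_sym.
- by move=> *; apply: me_trans; eassumption.
- move=> a b b' c d d' h1 h2 h1' h2' k1 k2 k1' k2' u1 u2 v1 v2 w1 w2
    f1 g1 f2 g2 ff tff gg tgg.
  apply: me_trans (t_ehcomp _ _) _; apply: me_trans _ (me_sym (t_ehcomp _ _)).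
  (* Each factor is whiskered by a boundary of the other cell, so the congruence of one pair
     supplies the equation of 1-morphisms needed for the other. *)
  have [_ ek _ _] := cell_eq_boundary ff.
  have [eh _ _ _] := cell_eq_boundary gg.
  apply: vcomp_cast_eq; first by apply: whiskerr_eq tff; rewrite eh.
  by apply: whiskerl_eq tgg; rewrite ek.
- move=> a b c d c' d' h1 h2 k1 k2 l1 l2 v1 v2 v1' v2' w1 w2 w1' w2'
    f1 g1 f2 g2 ff tff gg tgg.
  apply: me_trans (t_evcomp _ _) _; apply: me_trans _ (me_sym (t_evcomp _ _)).
  have [_ _ _ ew] := cell_eq_boundary ff.
  have [_ _ ev _] := cell_eq_boundary gg.
  apply: vcomp_cast_eq; first by apply: whiskerl_eq tff; rewrite ev.
  by apply: whiskerr_eq tgg; rewrite ew.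
- move=> a b c d h k v w f; apply: me_trans (t_ehcomp _ _) _.
  (* In all four unit laws [f] is whiskered by the image of an identity, which computes to [fid],
     while the other factor is a whiskered identity 2-morphism. *)
  apply: vcomp_cast_idl _ (me_hunitl _).
  exact: me_trans (whiskerr_eq erefl (t_eidv v)) (me_hid _ _).
- move=> a b c d h k v w f; apply: me_trans (t_ehcomp _ _) _.
  apply: vcomp_cast_idr _ (me_hunitr _).
  exact: me_trans (whiskerl_eq erefl (t_eidv w)) (me_hid _ _).
- move=> a b c d h k v w f; apply: me_trans (t_evcomp _ _) _.
  apply: vcomp_cast_idl _ (me_hunitr _).
  exact: me_trans (whiskerl_eq erefl (t_eidh h)) (me_hid _ _).
- move=> a b c d h k v w f; apply: me_trans (t_evcomp _ _) _.
  apply: vcomp_cast_idr _ (me_hunitl _).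
  exact: me_trans (whiskerr_eq erefl (t_eidh k)) (me_hid _ _).
- by move=> *; apply: t_hassoc.
- by move=> *; apply: t_vassoc.
- by move=> *; apply: t_exchange.
- move=> a b c h h'; apply: me_trans (t_ehcomp _ _) _.
  apply: me_trans _ (me_sym (t_eidh _)); apply: vcomp_cast_idl.
    exact: me_trans (whiskerr_eq erefl (t_eidh h)) (me_hid _ _).
  apply: me_trans (whiskerl_eq erefl (t_eidh h')) _.
  exact: me_trans (me_hid _ _) (mor2_eq_id (esym (hmor_comp _ _))).
- move=> a b c v v'; apply: me_trans (t_evcomp _ _) _.
  apply: me_trans _ (me_sym (t_eidv _)); apply: vcomp_cast_idl.
    exact: me_trans (whiskerl_eq erefl (t_eidv v)) (me_hid _ _).
  apply: me_trans (whiskerr_eq erefl (t_eidv v')) _.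
  exact: me_trans (me_hid _ _) (mor2_eq_id (esym (vop_comp _ _))).
(* [hmor (fid a)] and [vop (fid a)] both compute to [fid a], so the two identities coincide. *)
- by move=> a; apply: me_trans (t_eidh (fid a)) (me_sym (t_eidv (fid a))).
Qed.

End Translation.

Theorem lemma1 (S : double_signature) :
  (forall (a b c d : obj S)
     (h h' : free (hor S) a b) (k k' : free (hor S) c d)
     (v v' : free (ver S) a c) (w w' : free (ver S) b d)
     (phi : expr h k v w) (psi : expr h' k' v' w'),
     cell_eq phi psi -> mor2_eq (t phi) (t psi)) /\
  (exists T : forall (a b c d : obj S)
     (h : free (hor S) a b) (k : free (hor S) c d)
     (v : free (ver S) a c) (w : free (ver S) b d),
     Sd_cell h k v w -> S2_mor (vop v ;; hmor h) (hmor k ;; vop w),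
   forall (a b c d : obj S)
     (h : free (hor S) a b) (k : free (hor S) c d)
     (v : free (ver S) a c) (w : free (ver S) b d) (phi : expr h k v w),
     T a b c d h k v w (\pi_(Sd_cell h k v w) phi) =
     \pi_(S2_mor (vop v ;; hmor h) (hmor k ;; vop w)) (t phi)).
Proof.
split=> [a b c d h h' k k' v v' w w' phi psi|]; first exact: t_eq.
(* The map translates a chosen representative; by [t_eq] the class of the result does not depend on
   the choice, since [repr] of the class of [phi] is congruent to [phi]. *)
exists (fun a b c d h k v w (x : Sd_cell h k v w) =>
  \pi_(S2_mor (vop v ;; hmor h) (hmor k ;; vop w)) (t (repr x))).
move=> a b c d h k v w phi.
apply/(eqquotP (S2_mor _ _))/asboolP/t_eq/asboolP.
by apply/(eqquotP (Sd_cell h k v w)); rewrite reprK.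
Qed.
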